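(* Let $d\ge 1$ be an integer. For $i=1,\dots,d+1$ let $n_i\ge 2$ be an integer, $\delta_i\in\mathbb{R}^d$, and let $\vec{\mathbf a}_i$ be an infinite sequence of vectors in $\{0,1,\dots,n_i-1\}^d$ with associated location function $\mathcal{L}_{\vec{\mathbf a}_i}$. Let $\mathcal{G}_i:=\mathcal{G}(n_i,\delta_i,\mathcal{L}_{\vec{\mathbf a}_i})$ be the corresponding general dyadic grid with base $n_i$ on $\mathbb{R}^d$. Then $\mathcal{G}_1,\dots,\mathcal{G}_{d+1}$ are adjacent in $\mathbb{R}^d$ if and only if the projections of any two of them onto any coordinate axis are adjacent in $\mathbb{R}$; that is, if and only if for all $i\neq j$ in $\{1,\dots,d+1\}$ and all $s\in\{1,\dots,d\}$ the two grids $P_s(\mathcal{G}_i)$ and $P_s(\mathcal{G}_j)$ are adjacent in $\mathbb{R}$.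
   Context: Conventions: $\mathbb{N}=\{0,1,2,\dots\}$. For $v\in\mathbb{R}^d$, $(v)_s$ or $[v]_s$ denotes its $s$-th component. All cubes have sides parallel to the coordinate axes; $\ell(Q)$ is the sidelength of $Q$ (in $\mathbb{R}$, cubes are intervals). General dyadic grid with base $n$ ($n\ge 2$ an integer): a collection $\mathcal{G}$ of left-closed, right-open cubes $[a_1,a_1+\ell)\times\dots\times[a_d,a_d+\ell)$ in $\mathbb{R}^d$ such that (i) every $Q\in\mathcal{G}$ has sidelength $n^k$ for some $k\in\mathbb{Z}$; (ii) $Q\cap R\in\{Q,R,\emptyset\}$ for all $Q,R\in\mathcal{G}$; (iii) for each $k\in\mathbb{Z}$, the cubes of $\mathcal{G}$ of sidelength $n^k$ form a partition of $\mathbb{R}^d$. Location function: for $\vec{\mathbf a}=\{\vec a_0,\vec a_1,\dots\}$ with $\vec a_j\in\{0,1,\dots,n-1\}^d$ for all $j\ge 0$, define $\mathcal{L}_{\vec{\mathbf a}}:\mathbb{N}\to\mathbb{Z}^d$ by $\mathcal{L}_{\vec{\mathbf a}}(0)=\vec 0$ and $\mathcal{L}_{\vec{\mathbf a}}(j)=\sum_{i=0}^{j-1}n^i\vec a_i$ for $j\ge 1$. The grid $\mathcal{G}(n,\delta,\mathcal{L}_{\vec{\mathbf a}})$ (for $\delta\in\mathbb{R}^d$): the collection of all cubes in the following generations. For $m\ge 0$, the $m$-th generation consists of the cubes $\prod_{t=1}^d\left[(\delta)_t+\frac{k_t}{n^m},(\delta)_t+\frac{k_t+1}{n^m}\right)$,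 $(k_1,\dots,k_d)\in\mathbb{Z}^d$. For $m<0$, the $m$-th generation consists of the cubes $\prod_{t=1}^d\left[(\delta)_t+[\mathcal{L}_{\vec{\mathbf a}}(-m)]_t+\frac{k_t}{n^m},(\delta)_t+[\mathcal{L}_{\vec{\mathbf a}}(-m)]_t+\frac{k_t+1}{n^m}\right)$, $(k_1,\dots,k_d)\in\mathbb{Z}^d$. This is a general dyadic grid with base $n$. Projection: $P_s:\mathbb{R}^d\to\mathbb{R}$ is the orthogonal projection onto the $s$-th coordinate axis (identified with $\mathbb{R}$), and $P_s(\mathcal{G}):=\{P_s(Q):Q\in\mathcal{G}\}$; for $\mathcal{G}=\mathcal{G}(n,\delta,\mathcal{L}_{\vec{\mathbf a}})$ this is a general dyadic grid with base $n$ on $\mathbb{R}$. Adjacency (in $\mathbb{R}^d$, for any $d\ge1$): general dyadic grids $\mathcal{G}_1,\dots,\mathcal{G}_{d+1}$ on $\mathbb{R}^d$ with bases $n_1,\dots,n_{d+1}$ are adjacent if there is a constant $C>0$, independent of the cubes $Q$ and $D$ below, such that for every open cube $Q\subseteq\mathbb{R}^d$ there exist $i\in\{1,\dots,d+1\}$ and $D\in\mathcal{G}_i$ with $Q\subseteq D$ and $\ell(D)\le C\,\ell(Q)$. In particular, in $\mathbb{R}$ adjacency is a property of two grids. *)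

(* Defs.v *)
From mathcomp Require Import all_boot all_order all_algebra.
From mathcomp Require Import classical_sets reals.

Set Implicit Arguments.
Unset Strict Implicit.
Unset Printing Implicit Defensive.

Import Order.TTheory GRing.Theory Num.Theory.

Local Open Scope classical_set_scope.
Local Open Scope ring_scope.

Definition cube (R : realType) (d : nat) (c : 'rV[R]_d) (l : R) :
    set 'rV[R]_d :=
  [set x | forall t : 'I_d, x 0 t \in `[c 0 t, c 0 t + l[].

Definition open_cube (R : realType) (d : nat) (c : 'rV[R]_d) (l : R) :
    set 'rV[R]_d :=
  [set x | forall t : 'I_d, x 0 t \in `]c 0 t, c 0 t + l[].

Definition location (n d : nat) (a : nat -> 'rV['I_n]_d) (j : nat) :
    'rV[int]_d :=
  \row_(t < d) \sum_(i < j) n%:Z ^+ i * (a i 0 t : nat)%:Z.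

Definition grid_origin (R : realType) (d : nat) (delta : 'rV[R]_d)
    (L : nat -> 'rV[int]_d) (m : int) : 'rV[R]_d :=
  if 0 <= m then delta else delta + map_mx intr (L `|m|%N).

(* A cube of generation m has sidelength 1 / n ^ m, also for m < 0. *)
Definition generation (R : realType) (n d : nat) (delta : 'rV[R]_d)
    (L : nat -> 'rV[int]_d) (m : int) : set (set 'rV[R]_d) :=
  [set Q | exists k : 'rV[int]_d,
     Q = cube (\row_(t < d) (grid_origin delta L m 0 t
                              + (k 0 t)%:~R / n%:R ^ m))
              (1 / n%:R ^ m)].

Definition grid (R : realType) (n d : nat) (delta : 'rV[R]_d)
    (L : nat -> 'rV[int]_d) : set (set 'rV[R]_d) :=
  [set Q | exists m : int, generation n delta L m Q].

(* The coordinate axis is identified with R^1 = 'rV[R]_1, so that a single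
   notion of adjacency serves both R^d and R. *)
Definition proj (R : realType) (d : nat) (s : 'I_d) (x : 'rV[R]_d) :
    'rV[R]_1 := \row_(_ < 1) x 0 s.

Definition proj_grid (R : realType) (d : nat) (s : 'I_d)
    (G : set (set 'rV[R]_d)) : set (set 'rV[R]_1) :=
  [set proj s @` Q | Q in G].

(* For 0 < d and 0 < l', the set D = cube c' l' determines l', which is
   therefore its sidelength. *)
Definition adjacent (R : realType) (d : nat)
    (G : 'I_d.+1 -> set (set 'rV[R]_d)) : Prop :=
  exists2 C : R, 0 < C &
    forall (c : 'rV[R]_d) (l : R), 0 < l ->
      exists (i : 'I_d.+1) (D : set 'rV[R]_d),
        [/\ G i D, open_cube c l `<=` D &
            exists (c' : 'rV[R]_d) (l' : R),
              [/\ 0 < l', D = cube c' l' & l' <= C * l]].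

Definition two_grids (R : realType) (G H : set (set 'rV[R]_1)) :
    'I_2 -> set (set 'rV[R]_1) :=
  fun k => if k == ord0 then G else H.

(* Main.v *)
Require Import Defs.
From mathcomp Require Import all_boot all_order all_algebra.
From mathcomp Require Import classical_sets reals boolp.
From mathcomp Require Import lra.

Set Implicit Arguments.
Unset Strict Implicit.
Unset Printing Implicit Defensive.

Import Order.TTheory GRing.Theory Num.Theory.

Local Open Scope classical_set_scope.
Local Open Scope ring_scope.

(** Fix a coordinate t and a generation m of one grid. Its cubes project onto
    consecutive intervals of length n^-m; say that the generation cuts an
    interval in coordinate t if one of their endpoints lies strictly inside
    it. An open cube is contained in a cube of generation m exactly when
    generation m cuts none of its sides ([uncutP]). Hence adjacency, both in
    dimension d and of two projections, only says: for some constant C, every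
    open cube of sidelength l admits a grid and a generation of side at most
    C l that cuts none of its sides ([adjacent_gridP], [adjacent_projP]).
    What makes the argument work is that generations are nested: an endpoint
    of a coarse generation is an endpoint of all finer ones
    ([endpoint_refine]), so that cuts persist under refinement
    ([cut_refine]).

    Adjacency in dimension d implies adjacency of the projections of grids i
    and j to axis s, with the same constant. Given an interval, make it the
    s-th side of a cube. There are d - 1 other grids and d - 1 other
    coordinates; match them ([lift_cover]) and place each remaining side
    around an endpoint of a generation of the matching grid that has side at
    least C l. That grid then cuts the cube in all generations of side at most
    C l, so only grid i or grid j can contain the cube.

    Conversely, let C bound the constants of all the pairs. Given a cube of
    sidelength l, choose in each grid i a generation m_i with side between C l
    and n_i C l ([side_between]). If each of them cuts the cube, then, there
    being d + 1 grids and only d coordinates, two grids i and j cut the same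
    side s. By nesting they cut it also in all their generations of side at
    most C l, against the adjacency of their projections to axis s. So some m_i
    cuts no side, and C max n_i is a constant for dimension d. *)

(** * Cubes *)

Lemma proj_cube (R : realType) (d : nat) (s : 'I_d) (c : 'rV[R]_d) (l : R) :
  0 < l -> proj s @` cube c l = cube (proj s c) l.
Proof.
move=> l0; apply/seteqP; split=> [_ [x cx <-] t|y cy]; first by rewrite !mxE.
exists (\row_t if t == s then y 0 0 else c 0 t).
  move=> t; rewrite mxE; case: eqP => [->|_]; last by rewrite in_itv /=; lra.
  by have := cy 0; rewrite mxE.
by apply/rowP=> t; rewrite !mxE eqxx (ord1 t).
Qed.

(** Turns inclusions of cubes into inequalities. The sides of the inner cube are
    open, so it may share its extreme corners with the outer one; therefore
    the lemma compares half-open cubes just as well. *)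
Lemma open_cube_sub (R : realType) (d : nat) (c c' : 'rV[R]_d) (l l' : R) :
  open_cube c l `<=` cube c' l' <->
  (0 < l -> forall t, c' 0 t <= c 0 t /\ c 0 t + l <= c' 0 t + l').
Proof.
split=> [sub l0 t|sub x cx t]; last first.
  move: (cx t); rewrite !in_itv /= => /andP[h1 h2].
  by have [|h3 h4] := sub _ t; lra.
pose pt y : 'rV[R]_d := \row_u if u == t then y else c 0 u + l / 2.
have pt_sub y : c 0 t < y < c 0 t + l -> c' 0 t <= y < c' 0 t + l'.
  move=> cy; have /sub/(_ t) : open_cube c l (pt y).
    move=> u; rewrite mxE in_itv /=; case: eqP => [->//|_]; lra.
  by rewrite mxE eqxx in_itv.
(* If c' t is above c t, or c' t + l' below c t + l, then pt_sub fails
   halfway between the two bounds, or in the middle of the side ]c t, c t + l[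
   when the whole side lies beyond the bound of the outer cube. *)
split; rewrite leNgt; apply/negP => lt.
- have [le_l|lt_l] := leP l (c' 0 t - c 0 t).
    by have := pt_sub (c 0 t + l / 2) ltac:(apply/andP; split; lra); lra.
  have := pt_sub ((c 0 t + c' 0 t) / 2) ltac:(apply/andP; split; lra); lra.
- have [le_l|lt_l] := leP l (c 0 t + l - (c' 0 t + l')).
    by have := pt_sub (c 0 t + l / 2) ltac:(apply/andP; split; lra); lra.
  have := pt_sub ((c 0 t + l + (c' 0 t + l')) / 2)
    ltac:(apply/andP; split; lra); lra.
Qed.

(** * Nesting of the generations *)

Definition side (R : realType) (n : nat) (m : int) : R := 1 / n%:R ^ m.

Definition endpoint (R : realType) (n d : nat) (delta : 'rV[R]_d)
    (L : nat -> 'rV[int]_d) (m : int) (t : 'I_d) (k : int) : R :=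
  grid_origin delta L m 0 t + k%:~R / n%:R ^ m.

Lemma side_gt0 (R : realType) (n : nat) (m : int) :
  (0 < n)%N -> 0 < side R n m.
Proof. by move=> n0; rewrite divr_gt0 // exprz_gt0 // ltr0n. Qed.

Lemma sideS (R : realType) (n : nat) (m : int) :
  (0 < n)%N -> side R n m = n%:R * side R n (m + 1).
Proof.
move=> n0; have nN0 : n%:R != 0 :> R by rewrite pnatr_eq0 -lt0n.
by rewrite /side expfzDr // expr1z !div1r invfM mulrC divfK.
Qed.

Lemma ltr_side (R : realType) (n : nat) (m m' : int) :
  (1 < n)%N -> m < m' -> side R n m' < side R n m.
Proof.
move=> n1; have n0 := ltnW n1.
have step p : side R n (p + 1) < side R n p.
  by rewrite (sideS _ p n0) ltr_pMl ?side_gt0 // ltr1n.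
rewrite -subr_gt0 => lt; rewrite -(subrK m m') addrC.
case: (m' - m) lt => // -[//|j] _; elim: j => [|j IH]; first exact: step.
by rewrite -addn1 PoszD addrA (lt_trans (step _)).
Qed.

Lemma endpointS (R : realType) (n d : nat) (delta : 'rV[R]_d)
    (L : nat -> 'rV[int]_d) (m : int) (t : 'I_d) (k : int) :
  endpoint n delta L m t (k + 1) = endpoint n delta L m t k + side R n m.
Proof. by rewrite /endpoint /side intrD mulrDl addrA. Qed.

Lemma ltr_endpoint (R : realType) (n d : nat) (delta : 'rV[R]_d)
    (L : nat -> 'rV[int]_d) (m : int) (t : 'I_d) (k k' : int) :
  (0 < n)%N ->
  (endpoint n delta L m t k < endpoint n delta L m t k') = (k < k').
Proof.
by move=> n0; rewrite ltrD2l ltr_pM2r ?ltr_int // invr_gt0 exprz_gt0 // ltr0n.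
Qed.

(** The identity L(p+1) = L(p) + n^p a_p. At p = 0 the two sides fall under
    different branches of the definition of the origin, which agree because
    L(0) = 0. *)
Lemma grid_origin_step (R : realType) (n d : nat) (delta : 'rV[R]_d)
    (a : nat -> 'rV['I_n]_d) (p : nat) (t : 'I_d) :
  grid_origin delta (location a) (Negz p) 0 t =
  grid_origin delta (location a) (- p%:Z) 0 t +
    n%:R ^+ p * (a p 0 t)%:R.
Proof.
have -> : grid_origin delta (location a) (- p%:Z) 0 t =
          delta 0 t + (location a p 0 t)%:~R.
  case: p => [|p]; rewrite /grid_origin /= ?mxE //.
  by rewrite big_ord0 addr0.
rewrite /grid_origin /= !mxE -addrA; congr (_ + _).
by rewrite big_ord_recr /= rmorphD rmorphM rmorphXn.
Qed.

(** Nesting. For m >= 0 a step of generation m is n steps of generation m + 1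
    and the origin stays. For m = -(p+1) the origin moves by n^p a_p, which is
    an integral number of steps of generation -p, because these have length
    n^p. *)
Lemma endpoint_refine (R : realType) (n d : nat) (delta : 'rV[R]_d)
    (a : nat -> 'rV['I_n]_d) (m m' : int) (t : 'I_d) (k : int) :
  (0 < n)%N -> m <= m' ->
  exists k', endpoint n delta (location a) m t k =
             endpoint n delta (location a) m' t k'.
Proof.
move=> n0; have nN0 : n%:R != 0 :> R by rewrite pnatr_eq0 -lt0n.
have step p h : exists h', endpoint n delta (location a) p t h =
                           endpoint n delta (location a) (p + 1) t h'.
  case: p => p.
    exists (h * n); rewrite /endpoint /grid_origin /=; congr (_ + _).
    by rewrite intrM expfzDr // expr1z invfM mulrACA divff // mulr1.
  exists ((a p 0 t)%:Z + h * n).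
  have -> : Negz p + 1 = - p%:Z by rewrite NegzE -addn1 PoszD opprD subrK.
  rewrite /endpoint grid_origin_step -addrA; congr (_ + _).
  rewrite NegzE -!exprnN !invrK intrD mulrDl intrM exprS.
  by rewrite [_ * (a p 0 t)%:R]mulrC mulrA.
rewrite -subr_ge0 => le; rewrite -(subrK m m') addrC.
case: (m' - m) le => // j _.
elim: j => [|j [k' ->]]; first by exists k; rewrite addr0.
by rewrite -addn1 PoszD addrA.
Qed.

(** Multiplying by a power of n reduces the claim to numbers at least 1, for
    which the least j with x <= n^j satisfies n^j <= n x. *)
Lemma side_between (R : realType) (n : nat) (x : R) :
  (1 < n)%N -> 0 < x -> exists m, x <= side R n m <= n%:R * x.
Proof.
move=> n1 x0; have n0 := ltnW n1.
have n_gt0 N : 0 < n%:R ^+ N :> R by rewrite exprn_gt0 // ltr0n.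
have pow_gt (y : R) : exists N, y < n%:R ^+ N.
  exists (Num.bound y); apply: lt_le_trans (upper_nthrootP (leqnn _)) _.
  by rewrite lerXn2r ?nnegrE ?ler_nat ?ler0n.
have [N ltN] := pow_gt x^-1.
have le1 : 1 <= x * n%:R ^+ N by rewrite mulrC -ler_pdivrMr // div1r ltW.
have [|j lej minj] := @ex_minnP (fun j => x * n%:R ^+ N <= n%:R ^+ j).
  by have [j ltj] := pow_gt (x * n%:R ^+ N); exists j; apply: ltW.
have -> : n%:R * x = n%:R * x * n%:R ^+ N / n%:R ^+ N.
  by rewrite mulfK ?gt_eqF.
exists (N%:Z - j%:Z).
have -> : side R n (N%:Z - j%:Z) = n%:R ^+ j / n%:R ^+ N.
  rewrite /side expfzDr ?pnatr_eq0 -?lt0n // -exprnN invfM invrK.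
  by rewrite mul1r mulrC.
rewrite ler_pdivlMr // lej /= ler_pM2r ?invr_gt0 // -mulrA.
case: j lej minj => [|j] lej minj.
  by rewrite expr0 mulr_ege1 ?ler1n.
rewrite exprS ler_pM2l ?ltr0n // leNgt; apply/negP => /ltW /minj.
by rewrite ltnn.
Qed.

(** * Adjacency in terms of cuts *)

Definition cut (R : realType) (n d : nat) (delta : 'rV[R]_d)
    (L : nat -> 'rV[int]_d) (m : int) (t : 'I_d) (c l : R) : Prop :=
  exists k, c < endpoint n delta L m t k < c + l.

(** The threshold b stands for C l: generations are compared through their
    sides, as these are what adjacency controls. *)
Lemma cut_refine (R : realType) (n d : nat) (delta : 'rV[R]_d)
    (a : nat -> 'rV['I_n]_d) (m m' : int) (t : 'I_d) (c l b : R) :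
  (1 < n)%N -> side R n m' <= b -> b <= side R n m ->
  cut n delta (location a) m t c l -> cut n delta (location a) m' t c l.
Proof.
move=> n1 le1 le2 [k ck].
have le_m : m <= m'.
  rewrite leNgt; apply/negP => /(ltr_side R n1).
  by rewrite ltNge (le_trans le1).
have [k' eqk] := endpoint_refine delta a t k (ltnW n1) le_m.
by exists k'; rewrite -eqk.
Qed.

(** If no endpoint is interior, the interval of generation m that contains c
    contains ]c, c + l[, since its right endpoint must be at least c + l.
    Conversely an endpoint inside ]c, c + l[ would lie strictly between two
    consecutive endpoints. *)
Lemma uncutP (R : realType) (n d : nat) (delta : 'rV[R]_d)
    (L : nat -> 'rV[int]_d) (m : int) (t : 'I_d) (c l : R) :
  (0 < n)%N -> 0 < l ->
  ~ cut n delta L m t c l <->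
  exists k, endpoint n delta L m t k <= c /\
            c + l <= endpoint n delta L m t k + side R n m.
Proof.
move=> n0 l0; split=> [uncut|[k [lek gek]] [k' /andP[ltk' gtk']]]; last first.
  have := le_lt_trans lek ltk'; rewrite ltr_endpoint //.
  have := lt_le_trans gtk' gek; rewrite -endpointS ltr_endpoint // ltzD1.
  by move=> /le_lt_trans h /h; rewrite ltxx.
have nm0 : 0 < n%:R ^ m :> R by rewrite exprz_gt0 // ltr0n.
pose k := Num.floor ((c - grid_origin delta L m 0 t) * n%:R ^ m).
have /andP[lek gtk] := floor_itv ((c - grid_origin delta L m 0 t) * n%:R ^ m).
exists k; split.
  by rewrite /endpoint -lerBrDl ler_pdivrMr.
rewrite leNgt -endpointS; apply/negP => ltk; apply: uncut; exists (k + 1).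
by rewrite ltk andbT /endpoint -ltrBlDl ltr_pdivlMr.
Qed.

(** A cube of generation m is a product of intervals chosen independently in
    each coordinate, so the coordinatewise criterion [uncutP] suffices. That
    d is positive is what lets a cube determine its sidelength. *)
Lemma adjacent_gridP (R : realType) (d : nat) (n : 'I_d.+1 -> nat)
    (delta : 'I_d.+1 -> 'rV[R]_d) (L : 'I_d.+1 -> nat -> 'rV[int]_d) :
  (0 < d)%N -> (forall i, 0 < n i)%N ->
  adjacent (fun i => grid (n i) (delta i) (L i)) <->
  exists2 C : R, 0 < C & forall (c : 'rV[R]_d) (l : R), 0 < l ->
    exists i m, side R (n i) m <= C * l /\
      forall t, ~ cut (n i) (delta i) (L i) m t (c 0 t) l.
Proof.
move=> d0 n0; split=> -[C C0 adj]; exists C => // c l l0.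
  have [i [D [[m [k ->]] sub [c' [l' [l'0 eqD lel']]]]]] := adj c l l0.
  exists i, m; split.
    apply: le_trans lel'.
    have : open_cube (\row_t endpoint (n i) (delta i) (L i) m t (k 0 t))
             (side R (n i) m) `<=` cube c' l'.
      rewrite -eqD; apply/open_cube_sub => _ t.
      by rewrite /endpoint !mxE; split.
    move/open_cube_sub => /(_ (side_gt0 R m (n0 i)) (Ordinal d0)).
    lra.
  move=> t; apply/uncutP => //; exists (k 0 t).
  by move/open_cube_sub : sub => /(_ l0 t); rewrite mxE.
have [i [m [les uncut]]] := adj c l l0.
have /fin_all_exists [k kP] t :=
  (uncutP (delta i) (L i) m t (c 0 t) (n0 i) l0).1 (uncut t).
pose corner := \row_t endpoint (n i) (delta i) (L i) m t (k t).
exists i, (cube corner (side R (n i) m)); split.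
- exists m, (\row_t k t); congr cube; apply/rowP => t.
  by rewrite /endpoint !mxE.
- by apply/open_cube_sub => _ t; rewrite mxE; apply: kP.
- by exists corner, (side R (n i) m); split=> //; apply: side_gt0.
Qed.

Lemma endpoint_proj (R : realType) (n d : nat) (delta : 'rV[R]_d)
    (L : nat -> 'rV[int]_d) (m : int) (s : 'I_d) (t : 'I_1) (k : int) :
  endpoint n (proj s delta) (fun j => \row__ L j 0 s) m t k =
  endpoint n delta L m s k.
Proof. by rewrite /endpoint /grid_origin; case: ifP; rewrite !mxE. Qed.

(** The projection of a grid is a grid of the same kind, so the criterion for
    adjacency in dimension d applies to projections with d = 1. *)
Lemma proj_gridE (R : realType) (n d : nat) (delta : 'rV[R]_d)
    (L : nat -> 'rV[int]_d) (s : 'I_d) :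
  (0 < n)%N ->
  proj_grid s (grid n delta L) =
  grid n (proj s delta) (fun j => \row__ L j 0 s).
Proof.
move=> n0; have cornerE m (k : 'rV[int]_d) (k' : 'rV_1) : k' 0 0 = k 0 s ->
    proj s (\row_t endpoint n delta L m t (k 0 t)) =
    \row_t endpoint n (proj s delta) (fun j => \row__ L j 0 s) m t (k' 0 t).
  by move=> kk; apply/rowP => t; rewrite !mxE endpoint_proj (ord1 t) kk.
apply/seteqP; split=> [_ [_ [m [k ->]] <-]|_ [m [k ->]]].
  exists m, (\row__ k 0 s); rewrite proj_cube; last exact: side_gt0.
  by congr cube; apply: (cornerE m k); rewrite mxE.
(* any cube of generation m with s-th index k 0 0 projects as required *)
exists (cube (\row_t endpoint n delta L m t ((\row__ k 0 0 : 'rV_d) 0 t))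
             (side R n m)).
  by exists m, (\row__ k 0 0).
rewrite proj_cube; last exact: side_gt0.
by congr cube; apply: (cornerE m (\row__ k 0 0)); rewrite mxE.
Qed.

Lemma adjacent_projP (R : realType) (d n1 n2 : nat) (delta1 delta2 : 'rV[R]_d)
    (L1 L2 : nat -> 'rV[int]_d) (s : 'I_d) :
  (0 < n1)%N -> (0 < n2)%N ->
  adjacent (two_grids (proj_grid s (grid n1 delta1 L1))
                      (proj_grid s (grid n2 delta2 L2))) <->
  exists2 C : R, 0 < C & forall c l : R, 0 < l ->
    exists m, (side R n1 m <= C * l /\ ~ cut n1 delta1 L1 m s c l) \/
              (side R n2 m <= C * l /\ ~ cut n2 delta2 L2 m s c l).
Proof.
move=> n1_gt0 n2_gt0; rewrite !proj_gridE //.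
pose n (i : 'I_2) := if i == ord0 then n1 else n2.
pose delta (i : 'I_2) := proj s (if i == ord0 then delta1 else delta2).
pose L (i : 'I_2) j : 'rV[int]_1 :=
  \row__ (if i == ord0 then L1 else L2) j 0 s.
have -> : two_grids (grid n1 (proj s delta1) (fun j => \row__ L1 j 0 s))
                    (grid n2 (proj s delta2) (fun j => \row__ L2 j 0 s)) =
          fun i => grid (n i) (delta i) (L i).
  by apply/funext => i; rewrite /two_grids /n /delta /L; case: eqP.
have cutE i m t c l : cut (n i) (delta i) (L i) m t c l <->
    cut (n i) (if i == ord0 then delta1 else delta2)
              (if i == ord0 then L1 else L2) m s c l.
  by split=> -[k ck]; exists k; move: ck; rewrite endpoint_proj.
rewrite adjacent_gridP // => [|i]; last by rewrite /n; case: ifP.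
split=> -[C C0 adj]; exists C => // c l l0.
  have [i [m [les uncut]]] := adj (\row__ c) l l0; exists m.
  move: les (uncut 0); rewrite mxE cutE /n.
  by case: eqP => _ les ?; [left|right].
have [m [[les uncut]|[les uncut]]] := adj (c 0 0) l l0.
  by exists ord0, m; split=> // t; rewrite cutE (ord1 t).
by exists ord_max, m; split=> // t; rewrite cutE (ord1 t).
Qed.

(** * The two implications *)

(** The d - 1 indices other than i and j are matched with the d - 1 coordinates
    other than s, both being enumerated by [lift]. *)
Lemma lift_cover (d : nat) (i j : 'I_d.+1) (s : 'I_d) : i != j ->
  exists g : 'I_d -> 'I_d.+1,
    forall k, k != i -> k != j -> exists2 t, t != s & g t = k.
Proof.
case: d i j s => [i j [//]|d i j s] /unlift_some[/= j0 -> _].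
exists (fun t => if unlift s t is Some u then lift i (lift j0 u) else i) => k.
rewrite eq_sym => /unlift_some[/= u -> _].
rewrite (inj_eq lift_inj) eq_sym => /unlift_some[/= v -> _].
by exists (lift s v); rewrite ?liftK // eq_sym neq_lift.
Qed.

Theorem corollary1p13 (R : realType) (d : nat) (hd : (1 <= d)%N)
    (n : 'I_d.+1 -> nat) (hn : forall i, (2 <= n i)%N)
    (delta : 'I_d.+1 -> 'rV[R]_d)
    (a : forall i : 'I_d.+1, nat -> 'rV['I_(n i)]_d) :
  let G := fun i : 'I_d.+1 => grid (n i) (delta i) (location (a i)) in
  adjacent G <->
  (forall (i j : 'I_d.+1) (s : 'I_d), i != j ->
     adjacent (two_grids (proj_grid s (G i)) (proj_grid s (G j)))).
Proof.
move=> G; have n0 i : (0 < n i)%N := ltnW (hn i).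
rewrite adjacent_gridP //; split=> [[C C0 adj] i j s nij|adj].
  apply/adjacent_projP => //; exists C => // c l l0.
  have Cl0 : 0 < C * l by apply: mulr_gt0.
  have [g g_onto] := lift_cover s nij.
  have /fin_all_exists [m0 coarse] k : exists m, C * l <= side R (n k) m.
    by have [m /andP[]] := side_between (hn k) Cl0; exists m.
  (* centre side t at an endpoint of a coarse generation of grid g t *)
  pose x t := endpoint (n (g t)) (delta (g t)) (location (a (g t)))
                       (m0 (g t)) t 0 - l / 2.
  have [k [m [les uncut]]] := adj (\row_t if t == s then c else x t) l l0.
  have [ki|nki] := eqVneq k i.
    by exists m; left; have := uncut s; rewrite mxE eqxx -ki.
  have [kj|nkj] := eqVneq k j.
    by exists m; right; have := uncut s; rewrite mxE eqxx -kj.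
  have [t nts gt] := g_onto k nki nkj.
  case: (uncut t); rewrite mxE (negPf nts).
  apply: cut_refine les (coarse k) _ => //; exists 0.
  by rewrite /x gt; lra.
pose uncut_by C i j s := forall c l : R, 0 < l ->
  exists m, (side R (n i) m <= C * l /\
             ~ cut (n i) (delta i) (location (a i)) m s c l) \/
            (side R (n j) m <= C * l /\
             ~ cut (n j) (delta j) (location (a j)) m s c l).
have /fin_all_exists2[Cp Cp0 CpP] : forall p : 'I_d.+1 * 'I_d.+1 * 'I_d,
    exists2 C : R, 0 < C & p.1.1 != p.1.2 -> uncut_by C p.1.1 p.1.2 p.2.
  move=> [[i j] s] /=; case: (eqVneq i j) => [_|nij]; first by exists 1.
  by have /adjacent_projP [//|//|C C0 CP] := adj i j s nij; exists C.
pose C := 1 + \sum_p Cp p.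
have C0 : 0 < C by rewrite ltr_wpDr // sumr_ge0 // => p _; apply: ltW.
have leC p : Cp p <= C.
  rewrite /C (bigD1 p) //= addrCA lerDl addr_ge0 // sumr_ge0 // => q _.
  exact: ltW.
(* any bound for all the n i will do *)
pose N := (\sum_i n i)%N.
have leN i : (n i <= N)%N by rewrite /N (bigD1 i) //= leq_addr.
exists (N%:R * C); first by rewrite mulr_gt0 // ltr0n (leq_trans (n0 ord0)).
move=> c l l0; have Cl0 : 0 < C * l by apply: mulr_gt0.
have /fin_all_exists [m mP] i := side_between (hn i) Cl0.
apply: contrapT => none.
have /fin_all_exists [f fP] i :
    exists t, cut (n i) (delta i) (location (a i)) (m i) t (c 0 t) l.
  apply: contrapT => uncut; apply: none; exists i, (m i); split.
    have /andP[_ /le_trans->] // := mP i.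
    by rewrite -mulrA ler_wpM2r ?ler_nat // ltW.
  by move=> t ct; apply: uncut; exists t.
(* pigeonhole: d + 1 grids cut d sides *)
have /injectivePn [i [j nij fij]] : ~~ injectiveb f.
  by apply/negP => /injectiveP/leq_card; rewrite !card_ord ltnn.
have [p] := CpP (i, j, f i) nij (c 0 (f i)) l l0.
have le_side k :
    side R (n k) p <= Cp (i, j, f i) * l -> side R (n k) p <= C * l.
  by move/le_trans; apply; rewrite ler_wpM2r // ltW.
case=> -[/le_side les]; apply.
  by have /andP[le_m _] := mP i; apply: cut_refine les le_m (fP i).
by have /andP[le_m _] := mP j; rewrite fij; apply: cut_refine les le_m (fP j).
Qed.
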